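(* Let $Q\in\mathbb{R}^{d\times d}$ be skew-symmetric, $M\in\mathbb{R}^{d\times d}$ symmetric, $A=QM$, and let $U:\mathbb{R}^d\to\mathbb{R}$ be a general cubic polynomial with homogeneous decomposition $$U(x)=U_3(x)+U_2(x)+U_1(x)+U_0,$$ where $U_j$ is homogeneous of degree $j$. Set $f=Q\nabla U$. Let $x_n,x_{n+1}\in\mathbb{R}^d$ satisfy the EKahan scheme with step size $h$, $$x_{n+1}=e^{hA}x_n+h\,\phi(hA)\Bigl(-\tfrac12 f(x_n)+2f\bigl(\tfrac{x_n+x_{n+1}}{2}\bigr)-\tfrac12 f(x_{n+1})\Bigr).$$ Then $$H_{n+1}-H_n=U_3(x_{n+1}-x_n),$$ so that the stepwise energy increment depends only on the cubic component of $U$. Here $H_n=\frac12x_n^{\mathsf T}Mx_n+U(x_n)$, and $H_{n+1}$ is defined likewise from $x_{n+1}$.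
   Context: $\phi(z)=\frac{e^z-1}{z}$ (entire function, $\phi(0)=1$), applied to matrices through its power series. The underlying system is $\dot x=Q\nabla H(x)$ with $H(x)=\frac12x^{\mathsf T}Mx+U(x)$, i.e. $\dot x=Ax+f(x)$. *)

(* Defs.v *)
From mathcomp Require Import all_boot all_order all_algebra.
From mathcomp Require Import all_classical all_reals all_analysis.
From mathcomp Require Import ring.
From mathcomp.multinomials Require mpoly.
(* The notations of mpoly clash with those of mathcomp-analysis. *)
Import -(notations) mpoly.
Import Order.TTheory GRing.Theory Num.Theory.
Import numFieldNormedType.Exports.

Set Implicit Arguments.
Unset Strict Implicit.
Unset Printing Implicit Defensive.

Local Open Scope classical_set_scope.
Local Open Scope ring_scope.

(* [a] applied to the matrix [B] as a power series; the limit is taken in the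
   normed space of matrices (junk if the series diverges, which never happens
   for the entire functions below). *)
Definition mx_pseries (R : realType) (d : nat) (a : nat -> R) (B : 'M[R]_d)
    : 'M[R]_d :=
  limn (series (fun k => a k *: B ^+ k)).

Definition expmx (R : realType) (d : nat) (B : 'M[R]_d) : 'M[R]_d :=
  mx_pseries (fun k => (k`!%:R)^-1) B.

Definition phi (R : realType) (z : R) : R :=
  if z == 0 then 1 else (expR z - 1) / z.

Definition phi_coef (R : realType) (k : nat) : R := (k.+1`!%:R)^-1.

(* [phi_coef] is the Taylor sequence of [phi]: the matrix function [phimx] is
   indeed [phi] applied through its power series. *)
Lemma phi_pseries (R : realType) (z : R) :
  pseries (@phi_coef R) z @ \oo --> phi z.
Proof.
rewrite /phi; case: eqVneq => [->|z0].
  apply: cvg_near_cst; exists 1%N => // n /= n0.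
  rewrite /pseries /series /= (big_ltn n0) expr0 /phi_coef /= invr1 mulr1.
  by rewrite big_nat big1 ?addr0// => -[|i] // _; rewrite exprS mul0r mulr0.
have -> : pseries (@phi_coef R) z =
    fun n => (series (exp_coeff z) n.+1 - 1) / z.
  apply/funext => n; rewrite /pseries /series /= big_nat_recl//= /exp_coeff /=.
  rewrite expr0 fact0 divr1 addrC addrA addNr add0r mulr_suml.
  apply: eq_bigr => i _; rewrite /phi_coef exprS; field.
  by rewrite z0 pnatr_eq0 -lt0n fact_gt0.
apply: cvgM; last exact: cvg_cst.
apply: cvgB; last exact: cvg_cst.
by rewrite (cvg_shiftS (series (exp_coeff z))); exact: is_cvg_series_exp_coeff.
Qed.

Definition phimx (R : realType) (d : nat) (B : 'M[R]_d) : 'M[R]_d :=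
  mx_pseries (@phi_coef R) B.

Definition mpoly_fun (R : realType) (d : nat) (p : mpoly.mpoly d R)
    (x : 'cV[R]_d) : R :=
  mpoly.meval (fun i => x i 0) p.

(* As usual, the zero polynomial is homogeneous of every degree. *)
Definition homogeneous (R : realType) (d j : nat) (p : mpoly.mpoly d R) : Prop :=
  p \is mpoly.ishomog1 j mpoly.mdeg.

Definition gradient (R : realType) (d : nat) (F : 'cV[R]_d -> R)
    (x : 'cV[R]_d) : 'cV[R]_d :=
  \col_i 'D_(delta_mx i 0) F x.

Definition hamiltonian (R : realType) (d : nat) (M : 'M[R]_d)
    (U : 'cV[R]_d -> R) (x : 'cV[R]_d) : R :=
  2^-1 * (x^T *m M *m x) 0 0 + U x.

Definition ekahan (R : realType) (d : nat) (A : 'M[R]_d)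
    (f : 'cV[R]_d -> 'cV[R]_d) (h : R) (x y : 'cV[R]_d) : Prop :=
  y = expmx (h *: A) *m x
      + h *: (phimx (h *: A) *m
               (- (2^-1 *: f x) + 2 *: f (2^-1 *: (x + y)) - 2^-1 *: f y)).

(* Main.v *)
Require Import Defs.
From mathcomp Require Import all_boot all_order all_algebra.
From mathcomp Require Import all_classical all_reals all_analysis.
From mathcomp Require Import ring lra.
From mathcomp.multinomials Require mpoly.
Import -(notations) mpoly.
Import Order.TTheory GRing.Theory Num.Theory numFieldNormedType.Exports.
Local Open Scope classical_set_scope.
Local Open Scope ring_scope.

(** Write [D = xn1 - xn], [V = h A], and let [g] be the combination
    [- 1/2 grad U (xn) + 2 grad U ((xn + xn1)/2) - 1/2 grad U (xn1)], so that
    the bracket of the scheme is [Q g]. Two independent facts are combined.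

    The linear part is conservative. Since [e^V = 1 + phi(V) V], the scheme
    reads [D = S (M xn + g)] with [S = h phi(V) Q] ([ekahan_increment]). The
    change of the quadratic energy is [D^T M xn + 1/2 D^T M D], and adding
    [D^T g] gives [w^T S w + 1/2 w^T S^T M S w] with [w = M xn + g]. This
    vanishes because [S + S^T + S^T M S = 0] ([phimx_skew]): skew-symmetry of
    [Q] gives [S^T = - h phi(-V) Q], which turns the identity into
    [phi(V) - phi(-V) = phi(-V) (e^V - 1)], that is, [phi(-V) e^V = phi(V)]
    ([phimxN_expmx]). As [V] may be singular, this is proved on power series:
    a Cauchy product ([mx_pseries_mul]) together with the vanishing of the
    alternating sum of binomial coefficients.

    The nonlinear part is a quadrature defect. Along the segment,
    [q(t) = U(xn + t D)] is a polynomial of degree at most 3 whose coefficient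
    of [t^3] is [U3(D)], and [D^T g = - 1/2 q'(0) + 2 q'(1/2) - 1/2 q'(1)].
    Applied to [q'], these weights integrate [1] and [t] exactly over [0, 1],
    while they send [t^2] to 0 instead of 1/3; hence they miss precisely the
    coefficient of [t^3], and [U(xn1) - U(xn) = D^T g + U3(D)]
    ([cubic_discrete_gradient]). *)

Set Implicit Arguments.
Unset Strict Implicit.
Unset Printing Implicit Defensive.

(** * Limits of matrices *)

Lemma cvg_mxP (R : realType) (m n : nat) (u : nat -> 'M[R]_(m, n))
    (L : 'M[R]_(m, n)) :
  (u k @[k --> \oo] --> L) <->
  (forall i j, u k i j @[k --> \oo] --> L i j).
Proof.
split=> [uL i j|uL].
  exact: (@cvg_comp _ _ _ u (fun N : 'M[R]_(m, n) => N i j) _ _ _ uL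
           (@coord_continuous R m n i j L)).
apply/cvgrPdist_le => e e0; near=> k.
rewrite /Num.Def.normr/= mx_normrE (bigmax_le _ (ltW e0))//= => i _.
rewrite !mxE/=.
move: i; near: k; apply: filter_forall => /= i.
exact: ((cvgrPdist_le _ _).1 (uL i.1 i.2)).
Unshelve. all: by end_near. Qed.

Lemma cvg_mulmx (R : realType) (m n p : nat) (u : nat -> 'M[R]_(m, n))
    (v : nat -> 'M[R]_(n, p)) (A : 'M[R]_(m, n)) (B : 'M[R]_(n, p)) :
  u k @[k --> \oo] --> A -> v k @[k --> \oo] --> B ->
  u k *m v k @[k --> \oo] --> A *m B.
Proof.
move=> /cvg_mxP uA /cvg_mxP vB; apply/cvg_mxP => i j.
have -> : (fun k => (u k *m v k) i j) = fun k => \sum_l u k i l * v k l j.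
  by apply/funext => k; rewrite mxE.
rewrite mxE; by apply: cvg_big => [|l _]; [exact: add_continuous|exact: cvgM].
Qed.

Lemma cvg_trmx (R : realType) (m n : nat) (u : nat -> 'M[R]_(m, n))
    (A : 'M[R]_(m, n)) :
  u k @[k --> \oo] --> A -> (u k)^T @[k --> \oo] --> A^T.
Proof.
move=> /cvg_mxP uA; apply/cvg_mxP => i j.
rewrite mxE (_ : (fun k => _) = fun k => u k j i) //.
by apply/funext => k; rewrite mxE.
Qed.

(** * Power series of matrices *)

(** The entrywise form, with the sum of all [`|B i j|] as [r], reduces every
    convergence question below to a scalar exponential series. *)
Lemma exprmx_bound (R : realType) (d : nat) (B : 'M[R]_d) :
  exists2 r : R, 0 <= r & forall k i j, `|(B ^+ k) i j| <= r ^+ k.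
Proof.
pose r := \sum_i \sum_j `|B i j|.
have r0 : 0 <= r by do 2![apply: sumr_ge0 => ? _].
exists r => // k; elim: k => [|k IH] i j.
  by rewrite !expr0 mxE; case: (i == j); rewrite ?normr1 ?normr0.
rewrite [B ^+ _]exprS [r ^+ _]exprS mxE (le_trans (ler_norm_sum _ _ _))//.
apply: (@le_trans _ _ (\sum_l `|B i l| * r ^+ k)).
  by apply: ler_sum => l _; rewrite normrM ler_wpM2l.
rewrite -mulr_suml ler_wpM2r ?exprn_ge0// /r [leRHS](bigD1 i) //= lerDl.
by do 2![apply: sumr_ge0 => ? _].
Qed.

(** Coefficients bounded by [1/k!] make every entry of the series converge
    absolutely, by comparison with the exponential of the bound [r] above. *)
Lemma cvg_mx_pseries (R : realType) (d : nat) (a : nat -> R) (B : 'M[R]_d) :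
  (forall k, `|a k| <= k`!%:R^-1) ->
  series (fun k => a k *: B ^+ k) @ \oo --> mx_pseries a B.
Proof.
move=> ha; have [r r0 hr] := exprmx_bound B.
have cv i j : cvgn (series (fun k => a k * (B ^+ k) i j)).
  apply: normed_cvg; apply: series_le_cvg (is_cvg_series_exp_coeff r) => k //=.
    exact: exp_coeff_ge0.
  by rewrite normrM /exp_coeff /= mulrC ler_pM.
suff : cvgn (series (fun k => a k *: B ^+ k)) by [].
apply/cvg_ex.
exists (\matrix_(i, j) limn (series (fun k => a k * (B ^+ k) i j))).
apply/cvg_mxP => i j; rewrite mxE.
rewrite (_ : (fun k => _) = series (fun k => a k * (B ^+ k) i j)).
  exact: cv.
apply/funext => n; rewrite /series /= summxE; apply: eq_bigr => k _.
by rewrite mxE.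
Qed.

Lemma mx_pseries_tr (R : realType) (d : nat) (a : nat -> R) (B : 'M[R]_d) :
  (forall k, `|a k| <= k`!%:R^-1) -> (mx_pseries a B)^T = mx_pseries a B^T.
Proof.
move=> ha; apply: (@cvg_unique _ _ (series (fun k => a k *: B^T ^+ k) @ \oo)).
- exact: norm_hausdorff.
- rewrite (_ : series _ = fun n => (series (fun k => a k *: B ^+ k) n)^T).
    exact/cvg_trmx/cvg_mx_pseries.
  apply/funext => n; rewrite /series /= raddf_sum /=; apply: eq_bigr => k _.
  rewrite linearZ /=; congr (_ *: _).
  elim: k => [|k IH]; first by rewrite !expr0 trmx1.
  by rewrite exprSr exprS trmx_mul -IH.
- exact: cvg_mx_pseries.
Qed.

(** The intertwining relation passes to powers, hence to partial sums and to
    the limit. With [X = Q] it moves a skew-symmetric factor across [phimx];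
    with [X = B = C] it says that [B] commutes with its own series. *)
Lemma mx_pseries_intertwine (R : realType) (d : nat) (a : nat -> R)
    (B C X : 'M[R]_d) :
  (forall k, `|a k| <= k`!%:R^-1) -> X *m B = C *m X ->
  X *m mx_pseries a B = mx_pseries a C *m X.
Proof.
move=> ha XB.
apply: (@cvg_unique _ _ (X *m series (fun k => a k *: B ^+ k) n @[n --> \oo])).
- exact: norm_hausdorff.
- apply: (cvg_mulmx (u := fun=> X)); first exact: cvg_cst.
  exact: cvg_mx_pseries.
- rewrite (_ : (fun n => _) = fun n => series (fun k => a k *: C ^+ k) n *m X).
    apply: (cvg_mulmx (v := fun=> X)); last exact: cvg_cst.
    exact: cvg_mx_pseries.
  apply/funext => n; rewrite /series /= mulmx_sumr mulmx_suml.
  apply: eq_bigr => k _; rewrite -scalemxAr -scalemxAl; congr (_ *: _).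
  elim: k => [|k IH]; first by rewrite !expr0 mulmx1 mul1mx.
  rewrite [B ^+ _]exprS [C ^+ _]exprS -!mulmxE mulmxA XB -mulmxA IH.
  by rewrite mulmxA.
Qed.

Lemma sum_triangle (V : nmodType) (g : nat -> nat -> V) (n : nat) :
  \sum_(k < n) \sum_(i < k.+1) g i (k - i)%N =
  \sum_(i < n) \sum_(j < n - i) g i j.
Proof.
elim: n => [|n IH]; first by rewrite !big_ord0.
rewrite big_ord_recr IH [RHS]big_ord_recr /= subSnn big_ord1.
rewrite [X in _ + X = _]big_ord_recr /= subnn addrA; congr (_ + _).
rewrite -big_split /=; apply: eq_bigr => i _.
by rewrite subSn ?(ltnW (ltn_ord i))// big_ord_recr.
Qed.

(** The terms of the square missing from the triangle have [n <= i + j], so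
    that [r ^ (i + j) <= 2^-n (2 r) ^ (i + j)]: doubling the argument of the
    exponential pays for a geometric factor. *)
Lemma cauchy_corner_bound (R : realType) (r : R) (g : nat -> nat -> R)
    (n : nat) :
  0 <= r ->
  (forall i j, `|g i j| <= r ^+ (i + j) * (i`!%:R^-1 * j`!%:R^-1)) ->
  `|\sum_(i < n) \sum_(j < n) g i j - \sum_(i < n) \sum_(j < n - i) g i j|
    <= 2^-1 ^+ n * (expR (2 * r)) ^+ 2.
Proof.
move=> r0 hg.
have e0 k : 0 <= exp_coeff (2 * r) k by rewrite exp_coeff_ge0// mulr_ge0.
have hcorner i j : (n <= i + j)%N ->
    `|g i j| <= 2^-1 ^+ n * (exp_coeff (2 * r) i * exp_coeff (2 * r) j).
  move=> nij; apply: le_trans (hg i j) _.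
  rewrite /exp_coeff /= [X in _ <= _ * X]mulrACA -exprD [leRHS]mulrA.
  rewrite ler_wpM2r ?mulr_ge0 ?invr_ge0// exprMn mulrA.
  rewrite ler_peMl ?exprn_ge0// -(subnKC nij) exprD mulrA -exprMn.
  by rewrite mulVf// expr1n mul1r exprn_ege1// ler1n.
have hle : \sum_(i < n) exp_coeff (2 * r) i <= expR (2 * r).
  rewrite -(big_mkord xpredT) /expR.
  apply: nondecreasing_cvgn_le; last exact: is_cvg_series_exp_coeff.
  exact: nondecreasing_series.
rewrite -sumrB; apply: le_trans (ler_norm_sum _ _ _) _.
apply: (@le_trans _ _ (2^-1 ^+ n * ((\sum_(i < n) exp_coeff (2 * r) i) *
                               (\sum_(j < n) exp_coeff (2 * r) j)))).
  rewrite mulr_suml mulr_sumr; apply: ler_sum => i _.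
  rewrite mulr_sumr mulr_sumr.
  rewrite -!(big_mkord xpredT (g i)) -(big_mkord xpredT (fun j =>
    2^-1 ^+ n * (exp_coeff (2 * r) i * exp_coeff (2 * r) j))).
  rewrite !(big_cat_nat (leq0n (n - i)) (leq_subr i n)) /= addrAC subrr add0r.
  apply: le_trans (ler_norm_sum _ _ _) _.
  rewrite -[leLHS]add0r lerD ?sumr_ge0// => [j _|].
    by apply: mulr_ge0; [rewrite exprn_ge0|exact: mulr_ge0].
  rewrite !big_nat; apply: ler_sum => j /andP[nj _].
  by apply: hcorner; rewrite -leq_subLR.
rewrite expr2 ler_wpM2l ?exprn_ge0//.
by rewrite ler_pM// sumr_ge0.
Qed.

(** Cauchy product: the product of the partial sums and the partial sum of
    the product differ by the corner estimated in [cauchy_corner_bound]. *)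
Lemma mx_pseries_mul (R : realType) (d : nat) (a b : nat -> R) (B : 'M[R]_d) :
  (forall k, `|a k| <= k`!%:R^-1) -> (forall k, `|b k| <= k`!%:R^-1) ->
  mx_pseries a B *m mx_pseries b B =
  mx_pseries (fun k => \sum_(i < k.+1) a i * b (k - i)%N) B.
Proof.
move=> ha hb; have [r r0 hr] := exprmx_bound B.
pose c k := \sum_(i < k.+1) a i * b (k - i)%N.
suff cv : series (fun k => c k *: B ^+ k) @ \oo -->
    mx_pseries a B *m mx_pseries b B.
  exact/esym/(cvg_lim (@norm_hausdorff _ _)).
apply/cvg_mxP => i0 j0.
pose S n :=
  series (fun k => a k *: B ^+ k) n *m series (fun k => b k *: B ^+ k) n.
have hS : S n i0 j0 @[n --> \oo] --> (mx_pseries a B *m mx_pseries b B) i0 j0.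
  by move: i0 j0; apply/cvg_mxP/cvg_mulmx; exact: cvg_mx_pseries.
pose g i j := (a i * b j) * (B ^+ (i + j)) i0 j0.
have hg i j : `|g i j| <= r ^+ (i + j) * (i`!%:R^-1 * j`!%:R^-1).
  by rewrite /g !normrM mulrC ler_pM ?mulr_ge0// ler_pM.
have SE n : S n i0 j0 = \sum_(i < n) \sum_(j < n) g i j.
  rewrite /S /series /= !big_mkord mulmx_suml summxE; apply: eq_bigr => i _.
  rewrite mulmx_sumr summxE; apply: eq_bigr => j _.
  by rewrite -scalemxAl -scalemxAr scalerA mxE /g exprD.
have CE n : (series (fun k => c k *: B ^+ k) n) i0 j0 =
    \sum_(i < n) \sum_(j < n - i) g i j.
  rewrite -sum_triangle /series /= big_mkord summxE; apply: eq_bigr => k _.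
  rewrite mxE mulr_suml; apply: eq_bigr => i _.
  by rewrite /g subnKC// -ltnS.
have -> : (fun n => (series (fun k => c k *: B ^+ k) n) i0 j0) =
    fun n =>
      S n i0 j0 - (S n i0 j0 - (series (fun k => c k *: B ^+ k) n) i0 j0).
  by apply/funext => n; rewrite subKr.
rewrite -[X in _ --> X]subr0; apply: cvgB => //.
apply/norm_cvg0P.
apply: (@squeeze_cvgr _ _ _ _ (cst 0)
  (fun n => 2^-1 ^+ n * (expR (2 * r)) ^+ 2)).
- apply: nearW => n; rewrite normr_ge0 /= SE CE.
  exact: cauchy_corner_bound.
- exact: cvg_cst.
- rewrite -[X in _ --> X](mul0r (expR (2 * r) ^+ 2)).
  apply: cvgMr_tmp; apply: cvg_expr.
  by rewrite ger0_norm ?invr_ge0// invf_lt1// ltr1n.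
Qed.

(** * The exponential and phi of a matrix *)

Lemma norm_exp_coef (R : realType) (k : nat) :
  `|(k`!%:R^-1 : R)| <= k`!%:R^-1.
Proof. by rewrite ger0_norm. Qed.

Lemma norm_phi_coef (R : realType) (k : nat) :
  `|phi_coef R k| <= k`!%:R^-1.
Proof.
rewrite /phi_coef ger0_norm ?invr_ge0// lef_pV2 ?posrE ?ltr0n ?fact_gt0//.
by rewrite ler_nat factS leq_pmull.
Qed.

(** The relation [e^z = 1 + phi(z) z] holds between partial sums, up to a
    shift of the number of terms. *)
Lemma expmxE (R : realType) (d : nat) (B : 'M[R]_d) :
  expmx B = 1%:M + phimx B *m B.
Proof.
apply: (@cvg_unique _ _
  (series (fun k => k`!%:R^-1 *: B ^+ k) n.+1 @[n --> \oo])).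
- exact: norm_hausdorff.
- have := cvg_mx_pseries (B := B) (@norm_exp_coef R).
  by rewrite -(cvg_shiftS (series _)).
- rewrite (_ : (fun n => _) = fun n =>
    1%:M + series (fun k => phi_coef R k *: B ^+ k) n *m B).
    apply: cvgD; first exact: cvg_cst.
    apply: (cvg_mulmx (v := fun=> B)); last exact: cvg_cst.
    exact/cvg_mx_pseries/norm_phi_coef.
  apply/funext => n; rewrite /series /= big_nat_recl//= fact0 invr1 scale1r.
  rewrite expr0; congr (_ + _); rewrite mulmx_suml; apply: eq_bigr => k _.
  by rewrite -scalemxAl exprSr.
Qed.

Lemma phimxN (R : realType) (d : nat) (B : 'M[R]_d) :
  phimx (- B) = mx_pseries (fun k => (-1) ^+ k * phi_coef R k) B.
Proof.
rewrite /phimx /mx_pseries.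
suff -> : (fun k => phi_coef R k *: (- B) ^+ k) =
    fun k => ((-1) ^+ k * phi_coef R k) *: B ^+ k by [].
apply/funext => k; rewrite mulrC -scalerA; congr (_ *: _).
elim: k => [|k IH]; first by rewrite !expr0 scale1r.
by rewrite [(- B) ^+ k.+1]exprS IH [(-1) ^+ k.+1]exprS [B ^+ k.+1]exprS -!mulmxE
  mulN1r scaleNr mulNmx -scalemxAr.
Qed.

(** Multiplied by [(k + 1)!], this is the expansion of [(1 - 1)^(k + 1) = 0]
    with its first term moved to the other side. *)
Lemma phi_exp_coef_conv (R : realType) (k : nat) :
  \sum_(i < k.+1) ((-1) ^+ i * phi_coef R i) * (k - i)`!%:R^-1 = phi_coef R k.
Proof.
have := exprDn (1 : R) (-1) k.+1.
rewrite subrr expr0n /= big_ord_recl /= subn0 expr1n expr0 mulr1 bin0 mulr1n.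
move/(congr1 (fun z => z * phi_coef R k)); rewrite mul0r mulrDl mul1r mulr_suml.
move/esym/eqP; rewrite addrC addr_eq0 => /eqP h; rewrite -[RHS]opprK -h -sumrN.
apply: eq_bigr => i _.
rewrite /bump /= add1n expr1n mul1r exprS mulN1r.
rewrite mulNrn mulNr opprK -mulrA.
rewrite -[_ *+ 'C(_, _)]mulr_natr -[RHS]mulrA; congr (_ * _).
rewrite /phi_coef; have ik : (i.+1 <= k.+1)%N by [].
rewrite -(bin_fact ik) subSS (natrM _ 'C(_, _)) (natrM _ i.+1`!).
have f0 (n : nat) : (n`!%:R : R) != 0 by rewrite pnatr_eq0 -lt0n fact_gt0.
have b0 : ('C(k.+1, i.+1)%:R : R) != 0 by rewrite pnatr_eq0 -lt0n bin_gt0.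
by field; rewrite !f0 b0.
Qed.

(** Formally [phi(-z) e^z = ((1 - e^-z) / z) e^z = phi(z)]. *)
Lemma phimxN_expmx (R : realType) (d : nat) (B : 'M[R]_d) :
  phimx (- B) *m expmx B = phimx B.
Proof.
rewrite phimxN /expmx mx_pseries_mul; first last.
- exact: norm_exp_coef.
- by move=> k; rewrite normrM normrX normrN1 expr1n mul1r norm_phi_coef.
rewrite /phimx; congr mx_pseries; apply/funext => k.
exact: phi_exp_coef_conv.
Qed.

(** * The linear part of the scheme *)

(** Since [1 + S M = e^V] with [V = h Q M], this identity, multiplied by [M] on
    both sides, says that [e^V] preserves the quadratic form of [M]. It holds
    because [Q V^T = - V Q] gives [S^T = - h phi(-V) Q], hence
    [S^T M S = - h phi(-V) (e^V - 1) Q]. *)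
Lemma phimx_skew (R : realType) (d : nat) (Q M : 'M[R]_d) (h : R)
    (S := h *: (phimx (h *: (Q *m M)) *m Q)) :
  Q^T = - Q -> M^T = M -> S + S^T + S^T *m M *m S = 0.
Proof.
move=> hQ hM; pose V : 'M[R]_d := h *: (Q *m M).
have hST : S^T = - (h *: (phimx (- V) *m Q)).
  rewrite /S linearZ /= trmx_mul hQ mulNmx scalerN; congr (- (_ *: _)).
  rewrite /phimx mx_pseries_tr; last exact: norm_phi_coef.
  apply: mx_pseries_intertwine; first exact: norm_phi_coef.
  rewrite /V linearZ /= trmx_mul hQ hM mulmxN scalerN mulmxN mulNmx.
  by rewrite -scalemxAr -scalemxAl mulmxA.
have -> : S^T *m M *m S = - (h *: (phimx (- V) *m (phimx V *m V) *m Q)).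
  rewrite hST !mulNmx; congr (- _).
  rewrite (_ : phimx V *m V = V *m phimx V); last first.
    exact/esym/mx_pseries_intertwine/erefl/norm_phi_coef.
  rewrite /S -/V; set P := phimx V; set N := phimx (- V); rewrite /V.
  by rewrite !(=^~ scalemxAl, =^~ scalemxAr) !mulmxA.
have -> : phimx V *m V = expmx V - 1%:M by rewrite expmxE addrC addKr.
rewrite mulmxBr phimxN_expmx mulmx1 mulmxBl scalerBr hST /S -/V.
by rewrite opprB addrA subrK subrr.
Qed.

(** With [w = M x + g], the left-hand side is [w^T S w + 1/2 w^T S^T M S w],
    half of the quadratic form of [S + S^T + S^T M S] at [w]. *)
Lemma quadratic_increment (R : realType) (d : nat) (M S : 'M[R]_d)
    (x g : 'cV[R]_d) (D := S *m (M *m x + g)) :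
  M^T = M -> S + S^T + S^T *m M *m S = 0 ->
  2^-1 * ((x + D)^T *m M *m (x + D)) 0 0 - 2^-1 * (x^T *m M *m x) 0 0
  + (D^T *m g) 0 0 = 0.
Proof.
move=> hM hS; have [w wE] : {w | w = M *m x + g} by exists (M *m x + g).
have tr11 (N : 'M[R]_1) : N^T 0 0 = N 0 0 by rewrite mxE.
have add11 (N P : 'M[R]_1) : (N + P) 0 0 = N 0 0 + P 0 0 by rewrite mxE.
have DE : D = S *m w by rewrite wE.
have hw : 2 * (D^T *m w) 0 0 + (D^T *m M *m D) 0 0 = 0.
  have := congr1 (fun N : 'M[R]_d => (w^T *m N *m w) 0 0) hS.
  rewrite mulmx0 mul0mx !mulmxDr !mulmxDl.
  have -> : w^T *m (S^T *m M *m S) *m w = D^T *m M *m D.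
    by rewrite DE trmx_mul !mulmxA.
  have -> : w^T *m S^T *m w = D^T *m w by rewrite DE trmx_mul.
  have -> : w^T *m S *m w = (D^T *m w)^T.
    by rewrite DE !trmx_mul !trmxK mulmxA.
  rewrite !add11 tr11 mulr_natl mulr2n => ->; exact: mxE.
have hxD : (x^T *m M *m D) 0 0 = (D^T *m M *m x) 0 0.
  by rewrite -tr11 !trmx_mul trmxK hM mulmxA.
have := hw; rewrite {1}wE mulmxDr add11 mulmxA => {}hw.
rewrite [(x + D)^T]linearD /= !mulmxDl !mulmxDr.
set a := x^T *m M *m x; set b := x^T *m M *m D; set c := D^T *m M *m x.
set e := D^T *m M *m D.
rewrite !add11; move: hw hxD; rewrite -/b -/c -/e => hw ->; lra.
Qed.

(** * Polynomial functions along a line *)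

Definition line_poly (R : realType) (d : nat) (p : mpoly.mpoly d R)
    (x v : 'cV[R]_d) : {poly R} :=
  mpoly.mmap polyC (fun i => (x i 0)%:P + v i 0 *: 'X) p.

Lemma horner_line_poly (R : realType) (d : nat) (p : mpoly.mpoly d R)
    (x v : 'cV[R]_d) (t : R) :
  (line_poly p x v).[t] = mpoly_fun p (x + t *: v).
Proof.
rewrite /line_poly /mpoly_fun mpoly.mevalE /mpoly.mmap horner_sum.
apply: eq_bigr => m _; rewrite hornerM hornerC /mpoly.mmap1 horner_prod.
congr (_ * _); apply: eq_bigr => i _.
by rewrite !hornerE !mxE [v i 0 * t]mulrC.
Qed.

(** A bound on the size together with the coefficient at that bound is
    multiplicative. Tracking the coefficient at the nominal degree, instead of
    the leading one, covers the case where some [b i] vanish. *)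
Lemma poly_prod_top (R : realType) (I : Type) (r : seq I) (n : I -> nat)
    (a b : I -> R) :
  let q := \prod_(i <- r) ((a i)%:P + b i *: 'X) ^+ n i in
  let N := (\sum_(i <- r) n i)%N in
  (size q <= N.+1)%N /\ q`_N = \prod_(i <- r) b i ^+ n i.
Proof.
pose top (q : {poly R}) N c := (size q <= N.+1)%N /\ q`_N = c.
have topM (p q : {poly R}) m k c e :
    top p m c -> top q k e -> top (p * q) (m + k)%N (c * e).
  move=> [sp <-] [sq <-]; split.
    apply: leq_trans (size_polyMleq _ _) _.
    by rewrite -ltnS; case: (size p + size q)%N (leq_add sp sq) => // s;
      rewrite addSn addnS.
  rewrite coefM (bigD1 (inord m)) //= inordK ?ltnS ?leq_addr// addKn.
  rewrite big1 ?addr0// => i /eqP im.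
  have {im} : (i : nat) != m.
    apply/negP => /eqP im'; apply: im; apply/val_inj.
    by rewrite /= inordK ?ltnS ?leq_addr.
  rewrite neq_ltn => /orP[lim|lmi].
    rewrite [q`_ _]nth_default ?mulr0//; apply: leq_trans sq _.
    by rewrite ltn_subRL ltn_add2r.
  by rewrite nth_default ?mul0r//; exact: leq_trans sp _.
have top1 : top 1 0%N 1 by rewrite /top size_poly1 coef1.
have topX (c e : R) k : top ((c%:P + e *: 'X) ^+ k) k (e ^+ k).
  elim: k => [|k IH]; first by rewrite !expr0.
  rewrite !exprS -add1n; apply: topM IH; split.
    rewrite (leq_trans (size_polyD _ _))// geq_max.
    rewrite (leq_trans (size_polyC_leq1 _))//=.
    by rewrite (leq_trans (size_scale_leq _ _))// size_polyX.
  by rewrite coefD coefC coefZ coefX /= add0r mulr1.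
rewrite /=; elim: r => [|i r IH]; first by rewrite !big_nil.
by rewrite !big_cons; exact: topM.
Qed.

Lemma line_poly_homog (R : realType) (d j : nat) (p : mpoly.mpoly d R)
    (x v : 'cV[R]_d) :
  homogeneous j p ->
  (size (line_poly p x v) <= j.+1)%N /\ (line_poly p x v)`_j = mpoly_fun p v.
Proof.
move=> /mpoly.dhomogP hp.
have top m : m \in mpoly.msupp p ->
    let q := mpoly.mmap1 (fun i => (x i 0)%:P + v i 0 *: 'X) m in
    (size q <= j.+1)%N /\ q`_j = \prod_i v i 0 ^+ m i.
  move=> /hp mj; have -> : j = (\sum_i m i)%N by rewrite -mj -mpoly.mdegE.
  exact: poly_prod_top.
rewrite /line_poly /mpoly_fun mpoly.mevalE /mpoly.mmap; split.
  rewrite big_seq; apply: (big_ind (fun q : {poly R} => (size q <= j.+1)%N)).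
  - by rewrite size_poly0.
  - by move=> q1 q2 h1 h2; rewrite (leq_trans (size_polyD _ _))// geq_max h1.
  - move=> m /top[sm _]; rewrite mul_polyC.
    exact: leq_trans (size_scale_leq _ _) sm.
rewrite coef_sum !big_seq; apply: eq_bigr => m /top[_ cm].
by rewrite mul_polyC coefZ cm.
Qed.

Lemma differentiable_mpoly_fun (R : realType) (d : nat) (p : mpoly.mpoly d R)
    (x : 'cV[R]_d) :
  differentiable (mpoly_fun p) x.
Proof.
have prodd (m : 'I_d -> nat) (s : seq 'I_d) :
    differentiable (fun y : 'cV[R]_d => \prod_(i <- s) y i 0 ^+ m i) x.
  elim: s => [|i s IH].
    rewrite (_ : (fun y => _) = cst 1); first exact: differentiable_cst.
    by apply/funext => y; rewrite big_nil.
  rewrite (_ : (fun y => _) = (fun y : 'cV[R]_d => y i 0) ^+ m i *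
      (fun y : 'cV[R]_d => \prod_(i <- s) y i 0 ^+ m i)).
    apply: differentiableM => //.
    case: (m i) => [|k]; first exact: differentiable_cst.
    exact/differentiableX/differentiable_coord.
  by apply/funext => y; rewrite big_cons !fctE.
rewrite (_ : mpoly_fun p = fun y => \sum_(m <- mpoly.msupp p)
    mpoly.mcoeff m p * \prod_i y i 0 ^+ m i); last first.
  by apply/funext => y; rewrite /mpoly_fun mpoly.mevalE.
elim: (mpoly.msupp p) => [|m s IH].
  rewrite (_ : (fun y => _) = cst 0); first exact: differentiable_cst.
  by apply/funext => y; rewrite big_nil.
rewrite (_ : (fun y => _) = (mpoly.mcoeff m p *: (fun y : 'cV[R]_d =>
   \prod_i y i 0 ^+ m i)) + (fun y : 'cV[R]_d => \sum_(m <- s)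
    mpoly.mcoeff m p * \prod_i y i 0 ^+ m i)).
  by apply: differentiableD => //; apply/differentiableZ/prodd.
by apply/funext => y; rewrite big_cons.
Qed.

(** Only partial derivatives enter [gradient]; differentiability is what makes
    the directional derivative linear in the direction. *)
Lemma mulmx_gradient (R : realType) (d : nat) (F : 'cV[R]_d -> R)
    (x v : 'cV[R]_d) :
  differentiable F x -> (v^T *m gradient F x) 0 0 = 'D_v F x.
Proof.
move=> dF; rewrite deriveE// mxE.
have {2}-> : v = \sum_i v i 0 *: delta_mx i 0.
  rewrite [LHS]matrix_sum_delta; apply: eq_bigr => i _.
  by rewrite big_ord1.
rewrite linear_sum; apply: eq_bigr => i _.
by rewrite linearZ /= !mxE deriveE.
Qed.

Lemma derive_line_poly (R : realType) (d : nat) (p : mpoly.mpoly d R)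
    (x v : 'cV[R]_d) (t : R) :
  'D_v (mpoly_fun p) (x + t *: v) = (line_poly p x v)^`().[t].
Proof.
rewrite -(@derive_val _ _ _ _ _ _ _ (is_derive_poly (line_poly p x v) t)).
rewrite /derive.
set u := (X in X @ _); set w := (X in _ = lim (X @ _)).
suff -> : u = w by [].
apply/funext => h; rewrite /u /w /= !horner_line_poly.
by rewrite addrCA -scalerDl [h *: 1]mulr1.
Qed.

(** The weights [-1/2, 2, -1/2] at [0, 1/2, 1] integrate [1] and [t] over
    [0, 1] and send [t^2] to 0, so the derivative of [t^3] contributes nothing
    to them. *)
Lemma cubic_increment (R : realType) (q : {poly R}) :
  (size q <= 4)%N ->
  q.[1] - q.[0] =
  - (2^-1 * q^`().[0]) + 2 * q^`().[2^-1] - 2^-1 * q^`().[1] + q`_3.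
Proof.
move=> sq.
have : q = (q`_0)%:P + q`_1 *: 'X + q`_2 *: 'X^2 + q`_3 *: 'X^3.
  apply/polyP => i; rewrite !coefD coefC !coefZ coefX !coefXn.
  case: i => [|[|[|[|i]]]] /=; rewrite ?mulr0 ?mulr1 ?addr0 ?add0r//.
  by rewrite nth_default// (leq_trans sq).
move: (q`_0) (q`_1) (q`_2) (q`_3) => a b c e ->.
rewrite !derivD derivC !derivZ derivX !derivXn.
rewrite !(hornerD, hornerZ, hornerC, hornerX, hornerXn, hornerMn) /=.
by field.
Qed.

(** * The energy increment *)

Definition kahan_gradient (R : realType) (d : nat) (F : 'cV[R]_d -> R)
    (x y : 'cV[R]_d) : 'cV[R]_d :=
  - (2^-1 *: gradient F x) + 2 *: gradient F (2^-1 *: (x + y))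
  - 2^-1 *: gradient F y.

(** Reduction to [cubic_increment] for the restriction of [U] to the line from
    [x] to [y], whose coefficient of [t^3] only sees [U3]. *)
Lemma cubic_discrete_gradient (R : realType) (d : nat) (U : 'cV[R]_d -> R)
    (U3 U2 U1 U0 : mpoly.mpoly d R) (x y : 'cV[R]_d) :
  homogeneous 3 U3 -> homogeneous 2 U2 ->
  homogeneous 1 U1 -> homogeneous 0 U0 ->
  (forall z, U z = mpoly_fun U3 z + mpoly_fun U2 z
                   + mpoly_fun U1 z + mpoly_fun U0 z) ->
  U y - U x =
  ((y - x)^T *m kahan_gradient U x y) 0 0 + mpoly_fun U3 (y - x).
Proof.
move=> hU3 hU2 hU1 hU0 hU; set D := y - x.
pose P : mpoly.mpoly d R := U3 + U2 + U1 + U0.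
have UE : U = mpoly_fun P.
  by apply/funext => z; rewrite hU /mpoly_fun !mpoly.mevalD.
pose q := line_poly P x D.
have qE : q = line_poly U3 x D + line_poly U2 x D + line_poly U1 x D
              + line_poly U0 x D by rewrite /q /line_poly !mpoly.mmapD.
have [s3 c3] := line_poly_homog x D hU3.
have [s2 _] := line_poly_homog x D hU2.
have [s1 _] := line_poly_homog x D hU1.
have [s0 _] := line_poly_homog x D hU0.
have sq : (size q <= 4)%N.
  have sD (p r : {poly R}) : (size p <= 4)%N -> (size r <= 4)%N ->
      (size (p + r)%R <= 4)%N.
    by move=> sp sr; rewrite (leq_trans (size_polyD p r))// geq_max sp.
  rewrite qE; apply: (sD); first (apply: (sD); first apply: (sD)) => //.
  - exact: leq_trans s2 _.
  - exact: leq_trans s1 _.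
  - exact: leq_trans s0 _.
have q3 : q`_3 = mpoly_fun U3 D.
  rewrite qE !coefD c3 [X in _ + X]nth_default ?(leq_trans s0)//.
  rewrite [X in _ + X + _]nth_default ?(leq_trans s1)//.
  by rewrite [X in _ + X + _ + _]nth_default ?(leq_trans s2)// !addr0.
have e1 : y = x + 1 *: D by rewrite scale1r /D addrC subrK.
have e0 : x = x + 0 *: D by rewrite scale0r addr0.
have em : 2^-1 *: (x + y) = x + 2^-1 *: D.
  by apply/matrixP => i j; rewrite !mxE; field.
have hD t : (D^T *m gradient U (x + t *: D)) 0 0 = q^`().[t].
  rewrite UE mulmx_gradient ?derive_line_poly//.
  exact: differentiable_mpoly_fun.
have hUq t : U (x + t *: D) = q.[t] by rewrite UE horner_line_poly.
have -> : (D^T *m kahan_gradient U x y) 0 0 =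
    - (2^-1 * q^`().[0]) + 2 * q^`().[2^-1] - 2^-1 * q^`().[1].
  rewrite -!hD -e0 -e1 -em /kahan_gradient !(mulmxDr, mulmxN) -!scalemxAr.
  by rewrite !mxE.
by rewrite -q3 -cubic_increment// -!hUq -e0 -e1.
Qed.

(** Writing [e^V] as [1 + phi(V) V] lets the linear and the nonlinear term share
    the factor [h phi(V) Q]. *)
Lemma ekahan_increment (R : realType) (d : nat) (Q M : 'M[R]_d)
    (U : 'cV[R]_d -> R) (h : R) (x y : 'cV[R]_d) :
  ekahan (Q *m M) (fun z => Q *m gradient U z) h x y ->
  y - x = (h *: (phimx (h *: (Q *m M)) *m Q)) *m
          (M *m x + kahan_gradient U x y).
Proof.
rewrite /ekahan expmxE mulmxDl mul1mx -addrA => hs.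
rewrite {1}hs [LHS]addrC addKr.
have -> : - (2^-1 *: (Q *m gradient U x)) +
   2 *: (Q *m gradient U (2^-1 *: (x + y))) -
   2^-1 *: (Q *m gradient U y) = Q *m kahan_gradient U x y.
  by rewrite /kahan_gradient !(mulmxDr, mulmxN) -!scalemxAr.
by rewrite mulmxDr -!scalemxAl -scalemxAr -scalemxAl !mulmxA.
Qed.

Unset Implicit Arguments.
Set Strict Implicit.
Set Printing Implicit Defensive.

Theorem corollary1 (R : realType) (d : nat) (Q M A : 'M[R]_d)
    (U : 'cV[R]_d -> R) (U3 U2 U1 U0 : mpoly.mpoly d R)
    (f : 'cV[R]_d -> 'cV[R]_d) (h : R) (xn xn1 : 'cV[R]_d)
    (hQ : Q^T = - Q) (hM : M^T = M) (hA : A = Q *m M)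
    (hU3 : homogeneous 3 U3) (hU2 : homogeneous 2 U2)
    (hU1 : homogeneous 1 U1) (hU0 : homogeneous 0 U0)
    (hU : forall x, U x = mpoly_fun U3 x + mpoly_fun U2 x
                          + mpoly_fun U1 x + mpoly_fun U0 x)
    (hf : forall x, f x = Q *m gradient U x)
    (hstep : ekahan A f h xn xn1) :
  hamiltonian M U xn1 - hamiltonian M U xn = mpoly_fun U3 (xn1 - xn).
Proof.
have -> : hamiltonian M U xn1 - hamiltonian M U xn =
    2^-1 * (xn1^T *m M *m xn1) 0 0 - 2^-1 * (xn^T *m M *m xn) 0 0
    + (U xn1 - U xn) by rewrite /hamiltonian opprD addrACA.
have fE : f = fun x => Q *m gradient U x by apply/funext.
rewrite hA fE in hstep; have hD := ekahan_increment hstep.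
have := quadratic_increment xn (kahan_gradient U xn xn1) hM
          (phimx_skew h hQ hM).
rewrite -hD [xn + _]addrC subrK => hK.
rewrite (cubic_discrete_gradient xn xn1 hU3 hU2 hU1 hU0 hU) addrA.
by rewrite hK add0r.
Qed.
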